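(* Let $1\le i\le s-2$, let $\sigma_i$ be the $i$-th braid generator acting on $F_{s-1}$, and let $\mathbb{I}_{i,i+1}$ be the $(s-1)\times(s-1)$ matrix obtained from the identity matrix by swapping its $i$-th and $(i+1)$-th columns. Write $R^{-1}\mathbb{I}_{i,i+1}R=(a_{kl})_{1\le k,l\le s-1}$. (1) The automorphism of $F_{s-1}/F_{s-1}'$ induced by $\sigma_i$ maps $H^{\overline d}=\ker\alpha_{\overline d}/F_{s-1}'$ into itself if and only if $a_{1l}=0$ for all $2\le l\le s-1$. (2) The automorphism of $F_{s-1}/F_{s-1}'$ induced by $\sigma_i$ maps $H_n^{\overline d}=\ker(\pi\circ\alpha_{\overline d})/F_{s-1}'$ into itself if and only if $a_{1l}\in n\mathbb{Z}$ for all $2\le l\le s-1$.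
   Context: $F_{s-1}$ is the free group on $x_1,\ldots,x_{s-1}$ with commutator subgroup $F_{s-1}'$. The braid group on $s-1$ strands acts on $F_{s-1}$ through the generators $\sigma_i$, $1\le i\le s-2$, given by $\sigma_i(x_j)=x_j$ for $j\ne i,i+1$, $\sigma_i(x_{i+1})=x_i$, $\sigma_i(x_i)=x_ix_{i+1}x_i^{-1}$. Let $n\ge1$, let $\overline d=(d_1,\ldots,d_{s-1})$ be a tuple of integers none divisible by $n$, with $d=\gcd(d_1,\ldots,d_{s-1})$ prime to $n$. The homomorphism $\alpha_{\overline d}:F_{s-1}\to d\mathbb{Z}$ is given by $\alpha_{\overline d}(x_i)=d_i$, and $\pi:d\mathbb{Z}\to\mathbb{Z}/n\mathbb{Z}$ is reduction modulo $n$. $R\in\mathrm{SL}_{s-1}(\mathbb{Z})$ is a matrix with $(d_1,\ldots,d_{s-1})R=(d,0,\ldots,0)$. One identifies $F_{s-1}/F_{s-1}'$ with $\mathbb{Z}^{s-1}$ (column vectors) via the basis given by the classes of $x_1,\ldots,x_{s-1}$. *)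

(* Defs.v *)
(* boolp and classical_sets are used for the subgroup generated by a set and for
   the quotient by it. *)
From HB Require Import structures.
From mathcomp Require Import all_boot all_order all_algebra.
From mathcomp Require Import boolp classical_sets.

Set Implicit Arguments.
Unset Strict Implicit.
Unset Printing Implicit Defensive.

Local Open Scope classical_set_scope.
Local Open Scope group_scope.

(* The free group on X, as the type of reduced words.  The letter (x, false)
   stands for x and (x, true) for its inverse. *)

Notation letter X := (X * bool)%type.

Section Words.
Variable X : choiceType.

Implicit Types (a b : letter X) (u v w : seq (letter X)).

Definition inv_letter a : letter X := (a.1, ~~ a.2).

Definition reduced w : bool := sorted (fun a b => b != inv_letter a) w.

Definition cons_red a w : seq (letter X) :=
  if w is b :: w' then if b == inv_letter a then w' else a :: w else [:: a].

Definition mul_word u v : seq (letter X) := foldr cons_red v u.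

Definition inv_word u : seq (letter X) := rev (map inv_letter u).

Lemma inv_letterK : involutive inv_letter.
Proof. by case=> x b; rewrite /inv_letter /= negbK. Qed.

Lemma reduced_behead a w : reduced (a :: w) -> reduced w.
Proof. exact: path_sorted. Qed.

Lemma cons_red_reduced a w : reduced w -> reduced (cons_red a w).
Proof.
case: w => [|b w] //= rw; case: ifPn => [_|nb]; first exact: path_sorted rw.
by rewrite /reduced /= nb.
Qed.

Lemma cons_redK a w : reduced w -> cons_red (inv_letter a) (cons_red a w) = w.
Proof.
case: w => [|b w] /=; first by rewrite inv_letterK eqxx.
case: eqP => [->|_ _] /=; last by rewrite inv_letterK eqxx.
by case: w => [|c w] //= /andP[nc _]; rewrite (negPf nc).
Qed.

Lemma mul_word_reduced u v : reduced v -> reduced (mul_word u v).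
Proof. by move=> rv; elim: u => //= a u IHu; apply: cons_red_reduced. Qed.

Lemma mul_word_cons a u v :
  reduced v -> mul_word (cons_red a u) v = cons_red a (mul_word u v).
Proof.
move=> rv; case: u => [|b u] //=; case: eqP => [->|//].
by rewrite -{1}[a]inv_letterK cons_redK ?mul_word_reduced.
Qed.

Lemma mul_wordA u v w :
  reduced w -> mul_word u (mul_word v w) = mul_word (mul_word u v) w.
Proof. by move=> rw; elim: u => //= a u ->; rewrite mul_word_cons. Qed.

Lemma mul_word1 u : reduced u -> mul_word u [::] = u.
Proof.
elim: u => //= a u IHu ru; rewrite IHu; last exact: path_sorted ru.
by case: u ru {IHu} => [|b u] //= /andP[nb _]; rewrite (negPf nb).
Qed.

Lemma inv_word_reduced u : reduced u -> reduced (inv_word u).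
Proof.
rewrite /reduced /inv_word rev_sorted sorted_map; apply: sub_sorted => a b /=.
by apply: contraNneq => ->; rewrite inv_letterK.
Qed.

Lemma inv_wordK : involutive inv_word.
Proof.
by move=> u; rewrite /inv_word map_rev revK mapK //; apply: inv_letterK.
Qed.

Lemma mul_wordV u : mul_word (inv_word u) u = [::].
Proof.
elim: u => //= a u IHu; rewrite /inv_word /= rev_cons /mul_word foldr_rcons /=.
by rewrite inv_letterK eqxx.
Qed.

End Words.

Section FreeGroup.
Variable X : choiceType.

Record free_group := FreeGroup { word : seq (letter X); _ : reduced word }.

HB.instance Definition _ := [isSub for word].
HB.instance Definition _ := [Choice of free_group by <:].

Definition free_one := @FreeGroup [::] isT.
Definition free_mul (u v : free_group) :=
  FreeGroup (mul_word_reduced (word u) (valP v)).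
Definition free_inv (u : free_group) := FreeGroup (inv_word_reduced (valP u)).

Fact free_mulA : associative free_mul.
Proof. by move=> u v w; apply: val_inj; rewrite /= mul_wordA ?(valP w). Qed.
Fact free_mul1g : left_id free_one free_mul.
Proof. by move=> u; apply: val_inj. Qed.
Fact free_mulg1 : right_id free_one free_mul.
Proof. by move=> u; apply: val_inj; rewrite /= mul_word1 ?(valP u). Qed.
Fact free_mulVg : left_inverse free_one free_inv free_mul.
Proof. by move=> u; apply: val_inj; rewrite /= mul_wordV. Qed.
Fact free_mulgV : right_inverse free_one free_inv free_mul.
Proof.
move=> u; apply: val_inj; rewrite /= -{1}[word u]inv_wordK.
by rewrite mul_wordV.
Qed.

HB.instance Definition _ := isGroup.Build free_group
  free_mulA free_mul1g free_mulg1 free_mulVg free_mulgV.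

Definition free_gen (x : X) : free_group := @FreeGroup [:: (x, false)] isT.

Section Lift.
Variables (G : groupType) (f : X -> G).

Definition letter_val (a : letter X) : G := if a.2 then (f a.1)^-1 else f a.1.

(* The homomorphism to G with value f x at each generator x. *)
Definition free_lift (w : free_group) : G :=
  foldr (fun a g => letter_val a * g) 1 (word w).

Fact free_lift_monoid_morphism : monoid.monoid_morphism free_lift.
Proof.
split=> // u v; rewrite /free_lift /=; elim: (word u) => [|a s IHs] /=.
  by rewrite mul1g.
rewrite -mulgA -{}IHs; case: (mul_word s (word v)) => [|b w] //=.
case: eqP => [->|//] /=; rewrite mulgA /letter_val /=.
by case: a.2; rewrite /= ?mulVg ?mulgV mul1g.
Qed.

HB.instance Definition _ :=
  isUMagmaMorphism.Build free_group G free_lift free_lift_monoid_morphism.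

Lemma free_lift_gen x : free_lift (free_gen x) = f x.
Proof. exact: mulg1. Qed.

End Lift.

Lemma free_lift_unique (G : groupType) (h : UMagmaMorphism.type free_group G) :
  h =1 free_lift (h \o free_gen).
Proof.
case=> w rw; elim: w rw => [|a w IHw] rw.
  by rewrite -[RHS]/1 -(@gmulf1 _ _ h); congr (h _); apply: val_inj.
have rw' : reduced w by apply: reduced_behead rw.
have ra : reduced [:: a] by [].
have -> : FreeGroup rw = FreeGroup ra * FreeGroup rw'.
  apply: val_inj; rewrite /= /cons_red.
  by case: w rw {IHw rw'} => [|b w] //= /andP[/negPf->].
rewrite !gmulfM IHw; congr (_ * _).
rewrite -[RHS]/(letter_val (h \o free_gen) a * 1) mulg1.
case: a {rw} ra => x [] ra; rewrite /letter_val /=.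
  by rewrite -gmulfV; congr (h _); apply: val_inj.
by congr (h _); apply: val_inj.
Qed.

End FreeGroup.

Section Subgroups.
Variable G : groupType.

Definition is_subgroup (S : set G) : Prop :=
  S 1 /\ forall x y, S x -> S y -> S (x / y).

(* [~ x, y] is x^-1 * y^-1 * x * y. *)
Definition commutators : set G := [set z | exists x y, z = [~ x, y]].

Definition commutator_subgroup : set G := smallest is_subgroup commutators.

Lemma commutator_subgroupP : is_subgroup commutator_subgroup.
Proof.
split=> [S [[]]|x y Gx Gy S] //.
by move=> SP; apply: SP.1.2; [apply: Gx | apply: Gy].
Qed.

Lemma commutator_subgroupM x y : commutator_subgroup x ->
  commutator_subgroup y -> commutator_subgroup (x * y).
Proof.
move=> Gx Gy; have [G1 GF] := commutator_subgroupP.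
by rewrite -[y]invgK -[y^-1]mul1g; apply: (GF) => //; apply: GF.
Qed.

Lemma commutator_subgroupV x :
  commutator_subgroup x -> commutator_subgroup x^-1.
Proof.
by have [G1 GF] := commutator_subgroupP => Gx; rewrite -[x^-1]mul1g; apply: GF.
Qed.

Lemma commutator_subgroupR x y : commutator_subgroup [~ x, y].
Proof. by apply: sub_gen_smallest; exists x, y. Qed.

Lemma commutator_subgroupJ x y :
  commutator_subgroup x -> commutator_subgroup (x ^ y).
Proof.
move=> Gx; rewrite -[_ ^ _](mulVKg x) -commgEl.
by apply: commutator_subgroupM => //; apply: commutator_subgroupR.
Qed.

End Subgroups.

Definition hom_ker (G H : groupType) (f : G -> H) : set G := [set x | f x = 1].

(* The quotient G / G'. *)
Section Abelianization.
Variable G : groupType.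

Definition ab_rel (x y : G) : bool := `[< commutator_subgroup (x^-1 * y) >].

Fact ab_rel_refl : reflexive ab_rel.
Proof.
by move=> x; apply/asboolP; rewrite mulVg; case: (commutator_subgroupP G).
Qed.
Fact ab_rel_sym : symmetric ab_rel.
Proof.
suff sym x y : ab_rel x y -> ab_rel y x by move=> x y; apply/idP/idP => /sym.
move=> /asboolP xy; apply/asboolP.
by have /commutator_subgroupV := xy; rewrite invgM invgK.
Qed.
Fact ab_rel_trans : transitive ab_rel.
Proof.
move=> y x z /asboolP xy /asboolP yz; apply/asboolP.
by have := commutator_subgroupM xy yz; rewrite mulgA mulgK.
Qed.

Canonical ab_equiv := EquivRel ab_rel ab_rel_refl ab_rel_sym ab_rel_trans.

Definition abelianization : Type := {eq_quot ab_equiv}%qT.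
HB.instance Definition _ := Choice.on abelianization.

Definition ab_pi (x : G) : abelianization := (\pi_({eq_quot ab_equiv}) x)%qT.
Definition ab_repr (x : abelianization) : G := repr (x : {eq_quot ab_equiv}%qT).

Lemma ab_reprK : cancel ab_repr ab_pi.
Proof. exact: reprK. Qed.

Lemma ab_piP x y : ab_pi x = ab_pi y <-> commutator_subgroup (x^-1 * y).
Proof.
split=> [/(@eqquotP _ ab_equiv)/asboolP //|xy].
by apply/(@eqquotP _ ab_equiv)/asboolP.
Qed.

Definition ab_one := ab_pi 1.
Definition ab_mul x y := ab_pi (ab_repr x * ab_repr y).
Definition ab_inv x := ab_pi (ab_repr x)^-1.

Lemma ab_piM x y : ab_pi (x * y) = ab_mul (ab_pi x) (ab_pi y).
Proof.
have /esym/ab_piP xx' := ab_reprK (ab_pi x).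
have /esym/ab_piP yy' := ab_reprK (ab_pi y).
apply/ab_piP; set x' := ab_repr _ in xx' *; set y' := ab_repr _ in yy' *.
have -> : (x * y)^-1 * (x' * y') = (x^-1 * x') ^ y * (y^-1 * y').
  by rewrite conjgE invgM -!mulgA mulVKg.
by apply: commutator_subgroupM => //; apply: commutator_subgroupJ.
Qed.

Lemma ab_piV x : ab_pi x^-1 = ab_inv (ab_pi x).
Proof.
have /ab_piP xx' := ab_reprK (ab_pi x).
apply/ab_piP; set x' := ab_repr _ in xx' *.
have -> : x^-1^-1 * x'^-1 = (x'^-1 * x) ^ x'^-1.
  by rewrite conjgE !invgK !mulgA mulgV mul1g.
exact: commutator_subgroupJ.
Qed.

Fact ab_mulA : associative ab_mul.
Proof.
move=> x y z; rewrite -[x]ab_reprK -[y]ab_reprK -[z]ab_reprK.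
by rewrite -!ab_piM mulgA.
Qed.
Fact ab_mul1g : left_id ab_one ab_mul.
Proof. by move=> x; rewrite -[x]ab_reprK -ab_piM mul1g. Qed.
Fact ab_mulg1 : right_id ab_one ab_mul.
Proof. by move=> x; rewrite -[x]ab_reprK -ab_piM mulg1. Qed.
Fact ab_mulVg : left_inverse ab_one ab_inv ab_mul.
Proof. by move=> x; rewrite -[x]ab_reprK -ab_piV -ab_piM mulVg. Qed.
Fact ab_mulgV : right_inverse ab_one ab_inv ab_mul.
Proof. by move=> x; rewrite -[x]ab_reprK -ab_piV -ab_piM mulgV. Qed.

HB.instance Definition _ := isGroup.Build abelianization
  ab_mulA ab_mul1g ab_mulg1 ab_mulVg ab_mulgV.

HB.instance Definition _ := isUMagmaMorphism.Build G abelianization ab_pi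
  (conj (erefl _) ab_piM).

End Abelianization.

Lemma commutator_subgroup_hom (G H : groupType) (f : UMagmaMorphism.type G H)
    (x : G) : commutator_subgroup x -> commutator_subgroup (f x).
Proof.
apply: (@smallest_sub _ _ _ [set x | commutator_subgroup (f x)]) => {x}.
  have [H1 HF] := commutator_subgroupP H.
  split=> [|x y /= Hx Hy]; first by rewrite /= gmulf1.
  by rewrite gmulfF; apply: HF.
move=> _ [x [y ->]] /=; rewrite /commg /conjg !gmulfM !gmulfV.
exact: commutator_subgroupR.
Qed.

(* The homomorphism G / G' -> H / H' induced by f; ab_mapE shows that it is
   well defined. *)
Definition ab_map (G H : groupType) (f : UMagmaMorphism.type G H)
  (x : abelianization G) : abelianization H := ab_pi (f (ab_repr x)).

Lemma ab_mapE (G H : groupType) (f : UMagmaMorphism.type G H) (x : G) :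
  ab_map f (ab_pi x) = ab_pi (f x).
Proof.
apply/ab_piP; rewrite -gmulfV -gmulfM; apply: commutator_subgroup_hom.
exact/ab_piP/ab_reprK.
Qed.

Section AbMapMorphism.
Variables (G H : groupType) (f : UMagmaMorphism.type G H).

Fact ab_map_monoid_morphism : monoid.monoid_morphism (ab_map f).
Proof.
split=> [|x y]; first by rewrite ab_mapE gmulf1.
by rewrite -[x]ab_reprK -[y]ab_reprK -gmulfM !ab_mapE -!gmulfM.
Qed.

HB.instance Definition _ := isUMagmaMorphism.Build
  (abelianization G) (abelianization H) (ab_map f) ab_map_monoid_morphism.

End AbMapMorphism.

Section Braid.
Variable m : nat.

(* The free group F_{s-1} with s - 1 = m + 1, generators numbered from 0. *)
Local Notation Fs := (free_group 'I_m.+1).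

(* Since s - 2 = m, the index of a braid generator is i : 'I_m; the generators
   x_i and x_{i+1} that it moves are those numbered i and i + 1. *)
Definition strand (i : 'I_m) : 'I_m.+1 := widen_ord (leqnSn m) i.
Definition next_strand (i : 'I_m) : 'I_m.+1 := lift ord0 i.

Lemma strandE i : strand i = i :> nat. Proof. by []. Qed.
Lemma next_strandE i : next_strand i = i.+1 :> nat. Proof. by []. Qed.
Lemma next_strand_neq i : (next_strand i == strand i) = false.
Proof. by rewrite -val_eqE /= /bump /= add1n eqn_leq ltnn. Qed.

Definition sigma_gen (i : 'I_m) (j : 'I_m.+1) : Fs :=
  let x := @free_gen 'I_m.+1 in
  if j == strand i then x (strand i) * x (next_strand i) * (x (strand i))^-1
  else if j == next_strand i then x (strand i)
  else x j.

Definition sigma (i : 'I_m) : UMagmaMorphism.type Fs Fs :=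
  free_lift (sigma_gen i).

Definition sigmaV_gen (i : 'I_m) (j : 'I_m.+1) : Fs :=
  let x := @free_gen 'I_m.+1 in
  if j == strand i then x (next_strand i)
  else if j == next_strand i then
    (x (next_strand i))^-1 * x (strand i) * x (next_strand i)
  else x j.

Definition sigmaV (i : 'I_m) : UMagmaMorphism.type Fs Fs :=
  free_lift (sigmaV_gen i).

Lemma free_endo_id (h : UMagmaMorphism.type Fs Fs) :
  (forall j, h (free_gen j) = free_gen j) -> h =1 id.
Proof.
move=> hx w; rewrite free_lift_unique [RHS](free_lift_unique idfun).
by congr free_lift; apply/funext => j /=.
Qed.

Lemma sigmaK i : cancel (sigma i) (sigmaV i).
Proof.
move=> w; apply: (@free_endo_id (sigmaV i \o sigma i)) => j /=.
rewrite [sigma i _]free_lift_gen /sigma_gen.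
have sV k : sigmaV i (free_gen k) = sigmaV_gen i k by apply: free_lift_gen.
have [->|nl] := eqVneq j (strand i).
  rewrite !gmulfM gmulfV !sV /sigmaV_gen eqxx next_strand_neq eqxx.
  by rewrite !mulgA mulgV mul1g mulgK.
have [->|nh] := eqVneq j (next_strand i); rewrite sV /sigmaV_gen ?eqxx //.
by rewrite (negPf nl) (negPf nh).
Qed.

Lemma sigmaVK i : cancel (sigmaV i) (sigma i).
Proof.
move=> w; apply: (@free_endo_id (sigma i \o sigmaV i)) => j /=.
rewrite [sigmaV i _]free_lift_gen /sigmaV_gen.
have sV k : sigma i (free_gen k) = sigma_gen i k by apply: free_lift_gen.
have [->|nl] := eqVneq j (strand i).
  by rewrite sV /sigma_gen next_strand_neq eqxx.
have [->|nh] := eqVneq j (next_strand i).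
  rewrite !gmulfM gmulfV !sV /sigma_gen eqxx next_strand_neq eqxx.
  by rewrite !mulgA mulVg mul1g mulgVK.
by rewrite sV /sigma_gen (negPf nl) (negPf nh).
Qed.

Definition sigma_ab (i : 'I_m) :
    UMagmaMorphism.type (abelianization Fs) (abelianization Fs) :=
  ab_map (sigma i).

Lemma sigma_ab_bij i : bijective (sigma_ab i).
Proof.
exists (ab_map (sigmaV i)) => x; rewrite -[x]ab_reprK.
  by rewrite [sigma_ab i _]ab_mapE ab_mapE sigmaK.
by rewrite ab_mapE [sigma_ab i _]ab_mapE sigmaVK.
Qed.

Local Open Scope ring_scope.

Implicit Type dbar : 'rV[int]_m.+1.

Definition tuple_gcd dbar : int := \big[gcdz/0]_(j < m.+1) dbar ord0 j.

(* to_multiplicative Z is the additive group of Z written multiplicatively. *)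
Definition alpha dbar :
    UMagmaMorphism.type Fs (Algebra.to_multiplicative int) :=
  free_lift (fun j => dbar ord0 j : Algebra.to_multiplicative int).

(* The library's 'Z_n is Z/nZ only for n > 1; an n dividing none of the d_j is
   never 1. *)
Definition reduction (n : nat) (z : Algebra.to_multiplicative int) :
    Algebra.to_multiplicative 'Z_n :=
  (z : int)%:~R.

Lemma alpha_gen dbar j : alpha dbar (free_gen j) = dbar ord0 j.
Proof. exact: free_lift_gen. Qed.

Lemma alphaM dbar u v :
  alpha dbar (u * v)%g = (alpha dbar u : int) + alpha dbar v.
Proof. exact: (@gmulfM _ _ (alpha dbar)). Qed.

Lemma ker_alphaE dbar w : hom_ker (alpha dbar) w = (alpha dbar w = 0 :> int).
Proof. by []. Qed.

Lemma ker_reductionE n dbar w :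
  hom_ker (reduction n \o alpha dbar) w =
    ((alpha dbar w : int)%:~R = 0 :> 'Z_n).
Proof. by []. Qed.

Definition Hd dbar : set (abelianization Fs) :=
  @ab_pi Fs @` hom_ker (alpha dbar).

Definition Hd_mod (n : nat) dbar : set (abelianization Fs) :=
  @ab_pi Fs @` hom_ker (reduction n \o alpha dbar).

Definition swap_mx (i : 'I_m) : 'M[int]_m.+1 :=
  xcol (strand i) (next_strand i) 1%:M.

End Braid.

(* Main.v *)
Require Import Defs.
From mathcomp Require Import all_boot all_order all_algebra.
From mathcomp Require Import perm.
From mathcomp Require Import boolp classical_sets.

Import GRing.Theory.

Local Open Scope classical_set_scope.
Local Open Scope ring_scope.

(* The exponent-sum vector e : F -> Z^(m+1) is surjective, satisfies
   alpha dbar w = dbar e(w), and turns sigma_i into the matrix I_{i,i+1}.  In the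
   coordinates u = R^-1 e(w) one gets alpha dbar w = d u_1 and
   alpha dbar (sigma_i w) = d (A u)_1.  Both parts then say that the linear form
   u |-> (A u)_1 preserves divisibility of u_1 by k, with k = 0 for (1) and k = n
   for (2); the factor d may be dropped, being nonzero resp. prime to n. *)

(** A nonempty reduced word is its first letter, a generator or the inverse of one, times a shorter
    reduced word. *)
Lemma free_group_gen_ind (X : choiceType) (S : set (free_group X)) :
  is_subgroup S -> (forall x, S (free_gen x)) -> forall w, S w.
Proof.
move=> [S1 SF] Sx.
have SV u : S u -> S u^-1%g by move=> Su; rewrite -[(u^-1)%g]mul1g; apply: SF.
have SM u v : S u -> S v -> S (u * v)%g.
  by move=> Su Sv; rewrite -[v]invgK; apply/SF/SV.
case=> w rw; elim: w rw => [|a w IHw] rw.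
  by rewrite (_ : FreeGroup rw = 1%g) //; apply: val_inj.
have rw' : reduced w by apply: reduced_behead rw.
have ra : reduced [:: a] by [].
rewrite (_ : FreeGroup rw = (FreeGroup ra * FreeGroup rw')%g); last first.
  apply: val_inj; rewrite /= /cons_red.
  by case: w rw {IHw rw'} => [|b w] //= /andP[/negPf->].
apply: SM => //; case: a {rw} ra => x [] ra.
  rewrite (_ : FreeGroup ra = (free_gen x)^-1%g); first exact/SV/Sx.
  exact: val_inj.
by rewrite (_ : FreeGroup ra = free_gen x) //; apply: val_inj.
Qed.

Section ExponentSums.
Variable m : nat.
Local Notation Fs := (free_group 'I_m.+1).
Implicit Types (dbar : 'rV[int]_m.+1) (u v w : Fs).

Lemma alpha1 dbar : alpha dbar 1%g = 0 :> int.
Proof. exact: (@gmulf1 _ _ (alpha dbar)). Qed.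

Lemma alphaV dbar w : alpha dbar w^-1%g = - (alpha dbar w : int).
Proof. exact: (@gmulfV _ _ (alpha dbar)). Qed.

Lemma alphaF dbar u v : alpha dbar (u / v)%g = (alpha dbar u : int) - alpha dbar v.
Proof. by rewrite alphaM alphaV. Qed.

Lemma alpha_commutator_subgroup dbar w :
  commutator_subgroup w -> alpha dbar w = 0 :> int.
Proof.
apply: (@smallest_sub _ _ _ [set w | alpha dbar w = 0 :> int]) => {w}.
  split=> [|u v]; first exact: alpha1.
  by rewrite /mkset alphaF => u0 v0; rewrite u0 v0 subr0.
move=> _ [u [v ->]]; rewrite /mkset /commg /conjg !alphaM !alphaV.
by rewrite addrA -opprD addNr.
Qed.

(** Since Z is abelian, [alpha dbar] factors through F/F', so a condition on it can be tested on any
    representative of a class. *)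
Lemma alpha_ab_pi dbar u v :
  ab_pi u = ab_pi v -> alpha dbar u = alpha dbar v :> int.
Proof.
move=> /ab_piP /(alpha_commutator_subgroup dbar) /eqP.
by rewrite alphaM alphaV addrC subr_eq0 => /eqP.
Qed.

(** The coordinates of the class of [w] in F/F' = Z^(m+1). Taking [alpha] at the unit rows makes
    additivity immediate. *)
Definition exponent w : 'cV[int]_m.+1 := \col_j alpha (delta_mx 0 j) w.

Lemma exponentF u v : exponent (u / v)%g = exponent u - exponent v.
Proof. by apply/colP => j; rewrite !mxE alphaF. Qed.

Lemma exponent1 : exponent 1%g = 0.
Proof. by apply/colP => j; rewrite !mxE alpha1. Qed.

Lemma exponent_gen k : exponent (free_gen k) = delta_mx k 0.
Proof. by apply/colP => j; rewrite !mxE alpha_gen mxE eqxx andbT eq_sym. Qed.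

Lemma alpha_exponent dbar w : alpha dbar w = (dbar *m exponent w) ord0 ord0 :> int.
Proof.
move: w; apply: free_group_gen_ind => [|k].
  split=> [|u v Eu Ev]; first by rewrite alpha1 exponent1 mulmx0 mxE.
  by rewrite alphaF Eu Ev exponentF mulmxBr !mxE.
by rewrite alpha_gen exponent_gen -colE mxE.
Qed.

(** The image is a subgroup of Z^(m+1) containing every unit vector. *)
Lemma exponent_surj (v : 'cV[int]_m.+1) : exists w, exponent w = v.
Proof.
pose S (c : 'cV[int]_m.+1) := exists w, exponent w = c.
have SB c c' : S c -> S c' -> S (c - c').
  by move=> [w <-] [w' <-]; exists (w / w')%g; rewrite exponentF.
have S0 : S 0 by exists 1%g; rewrite exponent1.
have SN c : S c -> S (- c) by move=> Sc; rewrite -sub0r; apply: SB.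
have SD c c' : S c -> S c' -> S (c + c').
  by move=> Sc Sc'; rewrite -[c']opprK; apply/SB/SN.
have Sn c p : S c -> S (c *+ p).
  by move=> Sc; elim: p => [|p IHp]; rewrite ?mulr0n // mulrS; apply: SD.
rewrite -/(S v) [v]matrix_sum_delta; apply: (big_ind S) => // k _.
rewrite big_ord1; have Sk : S (delta_mx k 0).
  by exists (free_gen k); rewrite exponent_gen.
rewrite -[v k 0]intz scaler_int.
by case: (v k 0) => p; [apply: Sn|apply/SN/Sn].
Qed.

(** Both sides are homomorphisms in [w], so generators suffice; there the conjugate of x_{i+1} by
    x_i has the same value as x_{i+1}, and sigma_i acts as a transposition. *)
Lemma alpha_sigma dbar i w :
  alpha dbar (sigma i w) = alpha (dbar *m swap_mx i) w.
Proof.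
rewrite [LHS](free_lift_unique (alpha dbar \o sigma i) w).
congr free_lift; apply/funext => j.
rewrite /swap_mx xcolE mul1mx -xcolE mxE.
rewrite -[LHS]/(alpha dbar (sigma i (free_gen j))).
rewrite [sigma i _]free_lift_gen /sigma_gen.
case: tpermP => [->|->|/eqP/negPf-> /eqP/negPf->].
- by rewrite eqxx !alphaM alphaV !alpha_gen addrAC addrN add0r.
- by rewrite next_strand_neq eqxx alpha_gen.
- by rewrite alpha_gen.
Qed.

Lemma sigma_ab_stableP (k d : int) dbar (R : 'M[int]_m.+1) (i : 'I_m) :
    (forall x, (k %| d * x)%Z = (k %| x)%Z) ->
    R \in unitmx -> dbar *m R = \row_j (if j == ord0 then d else 0) ->
    let H := @ab_pi Fs @` [set w | (k %| (alpha dbar w : int))%Z] in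
    let A := invmx R *m swap_mx i *m R in
  sigma_ab i @` H `<=` H <-> forall l, l != ord0 -> (k %| A ord0 l)%Z.
Proof.
move=> kd uR dR H A.
have row0 (u : 'cV[int]_m.+1) : (dbar *m (R *m u)) ord0 ord0 = d * u ord0 ord0.
  rewrite mulmxA dR mxE (bigD1 ord0) //= big1 ?addr0 => [|j /negPf j0].
    by rewrite mxE eqxx.
  by rewrite mxE j0 mul0r.
have alphaR w : alpha dbar w = d * (invmx R *m exponent w) ord0 ord0 :> int.
  by rewrite -row0 mulKVmx // alpha_exponent.
have alpha_sigmaR w :
    alpha dbar (sigma i w) = d * (A *m (invmx R *m exponent w)) ord0 ord0 :> int.
  rewrite alpha_sigma alpha_exponent -row0 /A -!mulmxA.
  by rewrite (mulmxA R (invmx R) (_ *m _)) mulmxV // mul1mx mulKVmx.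
have HE w : H (ab_pi w) <-> (k %| (alpha dbar w : int))%Z.
  split=> [[v kv /(alpha_ab_pi dbar) <-] //|kw]; by exists w.
split=> [sH l l0|kA].
  (* In the coordinates u this [w] is the l-th unit vector: u_1 = 0 puts it in [H], and the first
     coordinate of its image is [A ord0 l]. *)
  have [w ew] := exponent_surj (R *m delta_mx l 0).
  have eRw : invmx R *m exponent w = delta_mx l 0 by rewrite ew mulKmx.
  have /HE : H (ab_pi (sigma i w)).
    apply: sH; exists (ab_pi w); last exact: ab_mapE.
    by apply/HE; rewrite alphaR eRw kd mxE eq_sym (negPf l0).
  by rewrite alpha_sigmaR eRw kd -colE mxE.
move=> _ [_ [w kw <-] <-].
rewrite [sigma_ab i _]ab_mapE; apply/HE.
rewrite alpha_sigmaR kd; move: kw; rewrite /mkset alphaR kd => kw.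
(* In the sum of the A_{1j} u_j, the first term is divisible because k divides u_1, the others
   because k divides A_{1j}. *)
rewrite mxE; apply: rpred_sum => j _.
have [->|j0] := eqVneq j ord0; first exact: dvdz_mull.
by apply/dvdz_mulr/kA.
Qed.

End ExponentSums.

(** The bound on [n] matters: ['Z_0] and ['Z_1] both have two elements. *)
Lemma intr_Zp_eq0 (n : nat) (z : int) :
  (1 < n)%N -> (z%:~R == 0 :> 'Z_n) = (n %| z)%Z.
Proof.
move=> n_gt1; have natE p : (p%:R == 0 :> 'Z_n) = (n %| p)%N.
  by rewrite -val_eqE /= val_Zp_nat.
by case: z => p; rewrite ?NegzE ?mulrNz ?oppr_eq0 ?dvdzN -pmulrn natE.
Qed.

Theorem mainTheorem4 (m n : nat) (dbar : 'rV[int]_m.+1) (R : 'M[int]_m.+1)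
    (i : 'I_m) :
  (0 < n)%N ->
  (forall j : 'I_m.+1, ~~ (n %| dbar ord0 j)%Z) ->
  coprimez (tuple_gcd dbar) n ->
  \det R = 1 ->
  dbar *m R = \row_j (if j == ord0 then tuple_gcd dbar else 0) ->
  let A := invmx R *m swap_mx i *m R in
  (sigma_ab i @` Hd dbar `<=` Hd dbar <->
     forall l : 'I_m.+1, l != ord0 -> A ord0 l = 0) /\
  (sigma_ab i @` Hd_mod n dbar `<=` Hd_mod n dbar <->
     forall l : 'I_m.+1, l != ord0 -> (n %| A ord0 l)%Z).
Proof.
move=> n_gt0 ndvd cop detR dR A.
have uR : R \in unitmx by rewrite unitmxE detR unitr1.
have n_gt1 : (1 < n)%N.
  by case: n n_gt0 ndvd {cop} => [|[|n]] // _ /(_ ord0); rewrite dvd1z.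
(* Otherwise the gcd with [n] would be [n] itself, which exceeds 1. *)
have d_neq0 : tuple_gcd dbar != 0.
  apply: contraTneq cop => ->; rewrite /coprimez gcd0z.
  by case: n n_gt1 {n_gt0 ndvd} => [|[]].
have -> : Hd dbar =
    @ab_pi _ @` [set w | (0 %| (alpha dbar w : int))%Z].
  congr image; apply/funext => w; apply/propext.
  by rewrite /= dvd0z; split=> /eqP.
have -> : Hd_mod n dbar =
    @ab_pi _ @` [set w | (n %| (alpha dbar w : int))%Z].
  congr image; apply/funext => w; apply/propext.
  by rewrite ker_reductionE /= -intr_Zp_eq0 //; split=> /eqP.
split.
  have [] := @sigma_ab_stableP m 0 (tuple_gcd dbar) dbar R i _ uR dR.
    by move=> x; rewrite !dvd0z mulf_eq0 (negPf d_neq0).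
  rewrite -/A => H1 H2; split=> [/H1 Al l /Al|Al].
    by rewrite dvd0z => /eqP.
  by apply: H2 => l /Al ->; rewrite dvd0z.
apply: (@sigma_ab_stableP m n (tuple_gcd dbar)) => // x.
(* Gauss's lemma cancels d, which is prime to [n]. *)
by rewrite Gauss_dvdzr // coprimez_sym.
Qed.
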